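(* Let $n=3$ and let $\hat\alpha=\bar X^2/S^2$ be the moment estimator of the shape parameter $\alpha$ based on a random sample $X_1,X_2,X_3$ from the gamma distribution with shape $\alpha>0$ and scale $\lambda>0$. Then $\hat\alpha$ is not increasing in $\alpha$ with respect to the star order; that is, it is not true that $\hat\alpha_1\leq_{*}\hat\alpha_2$ for all $0<\alpha_1<\alpha_2$, where $\hat\alpha_i$ denotes the estimator based on a sample of size $3$ from the gamma distribution with shape $\alpha_i$ ($i=1,2$).
   Context: The gamma distribution with shape $\alpha>0$ and scale $\lambda>0$ has density $f(x;\alpha,\lambda)=\frac{1}{\Gamma(\alpha)\lambda^{\alpha}}x^{\alpha-1}e^{-x/\lambda}$, $x>0$. A random sample is a collection of independent identically distributed random variables. For a sample $X_1,\dots,X_n$, $\bar X=\frac1n\sum_{i=1}^n X_i$ is the sample mean and $S^2=\frac1n\sum_{i=1}^n (X_i-\bar X)^2$ is the biased sample variance. For positive random variables $X,Y$ with continuous distribution functions $F,G$ strictly increasing on their (interval) supports, $X\leq_{*}Y$ (star order) means that $G^{-1}(F(x))/x$ is nondecreasing in $x>0$ on the support of $X$; equivalently, $G^{-1}(u)/F^{-1}(u)$ is nondecreasing in $u\in(0,1)$. *)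

(* Defs.v *)
From HB Require Import structures.
From mathcomp Require Import all_boot all_order all_algebra.
From mathcomp Require Import all_classical all_reals all_analysis.
From mathcomp Require Import measurable_realfun.

Set Implicit Arguments.
Unset Strict Implicit.
Unset Printing Implicit Defensive.

Import Order.TTheory GRing.Theory Num.Theory.
Import numFieldNormedType.Exports.

Local Open Scope classical_set_scope.
Local Open Scope ring_scope.

Definition Gamma {R : realType} (a : R) : R :=
  \int[lebesgue_measure]_(x in `]0%R, +oo[) (x `^ (a - 1) * expR (- x)).

Definition gamma_pdf {R : realType} (a l : R) : R -> R :=
  (fun x => (Gamma a * l `^ a)^-1 * x `^ (a - 1) * expR (- (x / l)))
    \_ `]0, +oo[.

(* For a finite family, the product rule over subfamilies is the case where
   some of the [A i] are [setT]. *)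
Definition mutually_independent {R : realType} d (T : measurableType d)
    (P : probability T R) n (X : 'I_n -> {RV P >-> R}) : Prop :=
  forall A : 'I_n -> set R, (forall i, measurable (A i)) ->
    P (\bigcap_(i in [set: 'I_n]) (X i @^-1` A i)) =
    (\prod_(i < n) P (X i @^-1` A i))%E.

Definition gamma_distributed {R : realType} d (T : measurableType d)
    (P : probability T R) (a l : R) (X : {RV P >-> R}) : Prop :=
  forall A : set R, measurable A ->
    distribution P X A =
    (\int[lebesgue_measure]_(x in A) (gamma_pdf a l x)%:E)%E.

Definition gamma_sample {R : realType} d (T : measurableType d)
    (P : probability T R) n (a l : R) (X : 'I_n -> {RV P >-> R}) : Prop :=
  mutually_independent X /\ forall i, gamma_distributed a l (X i).

Lemma measurable_inv (R : realType) : measurable_fun [set: R] (@GRing.inv R).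
Proof.
rewrite -(setUv [set (0 : R)]); apply/measurable_funU => //.
  exact: measurableC.
split; first exact: measurable_fun_set1.
apply: open_continuous_measurable_fun.
  by rewrite openC; exact: closed_eq.
by move=> x /[1!inE] /eqP x0; exact: inv_continuous.
Qed.

Section estimator.
Context {R : realType} d (T : measurableType d) (P : probability T R) (n : nat).
Variable X : 'I_n -> {RV P >-> R}.

Definition sample_mean (t : T) : R := n%:R^-1 * \sum_(i < n) X i t.

Definition sample_variance (t : T) : R :=
  n%:R^-1 * \sum_(i < n) (X i t - sample_mean t) ^+ 2.

(* On the event [sample_variance = 0], which is negligible for a gamma sample
   of size at least 2, division by zero makes the estimator 0. *)
Definition moment_estimator (t : T) : R :=
  sample_mean t ^+ 2 / sample_variance t.

Lemma measurable_sample_mean : measurable_fun [set: T] sample_mean.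
Proof.
apply: measurable_funM => //; apply: measurable_sum => i.
exact: measurable_funPT.
Qed.

Lemma measurable_sample_variance : measurable_fun [set: T] sample_variance.
Proof.
apply: measurable_funM => //; apply: measurable_sum => i.
apply: measurable_funX; apply: measurable_funB; first exact: measurable_funPT.
exact: measurable_sample_mean.
Qed.

Lemma measurable_moment_estimator : measurable_fun [set: T] moment_estimator.
Proof.
apply: measurable_funM.
  by apply: measurable_funX; exact: measurable_sample_mean.
apply: (measurableT_comp (@measurable_inv R)).
exact: measurable_sample_variance.
Qed.

HB.instance Definition _ :=
  isMeasurableFun.Build _ _ _ _ moment_estimator measurable_moment_estimator.

End estimator.

Definition quantile {R : realType} d (T : measurableType d)
    (P : probability T R) (X : {RV P >-> R}) (u : \bar R) : R :=
  inf [set x : R | (u <= cdf X x)%E].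

(* Meant for almost surely positive variables whose distribution functions F
   and G are continuous and strictly increasing on their interval supports.
   Then [quantile Y] is the inverse of G on ]0, 1[, and the condition 0 < F < 1
   singles out the interior of the support of X; as with u in ]0, 1[ in the
   quantile form of the order, endpoints (where the inverse of G at 0 or 1 need
   not be a real number) are left out. *)
Definition star_le {R : realType}
    d1 (T1 : measurableType d1) (P1 : probability T1 R) (X : {RV P1 >-> R})
    d2 (T2 : measurableType d2) (P2 : probability T2 R) (Y : {RV P2 >-> R}) :
    Prop :=
  {in [set x : R | 0 < x /\ (0 < cdf X x < 1)%E] &,
    nondecreasing_fun (fun x => quantile Y (cdf X x) / x)}.

(* Main.v *)
(* For a sample of size 3 the estimator [A] of the shape satisfies
   [A > 2] iff the square roots of the observations are the sides of a
   nondegenerate triangle, that is, iff the normalised sample lies in the disc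
   inscribed in the simplex. For shape at most 1/2 this disc touches the
   simplex at points where the Dirichlet density blows up, so that the density
   of [A] is infinite at 2, while it is locally bounded on ]1/2, 1]. Let G be
   the distribution function of [A] for shape 1/4 and F that for a small shape
   1/(n+1); as the shape tends to 0 the observations get incomparable, so
   F(1) > G(2) for n large and the point q with F(q) = G(2) lies in ]1/2, 1].
   At q the derivative of G^-1(F(x)) is f(q) / g(2) = 0, so that
   G^-1(F(x)) / x decreases there. Densities are avoided: F is locally
   Lipschitz and (G(2) - G(2 - h)) / h is unbounded, both by conditioning on
   two of the observations. *)

From HB Require Import structures.
Require Import Defs.
From mathcomp Require Import all_boot all_order all_algebra.
From mathcomp Require Import all_classical all_reals all_analysis.
From mathcomp Require Import measurable_realfun ring lra.
Import Order.TTheory GRing.Theory Num.Theory.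
Import numFieldNormedType.Exports.
Local Open Scope classical_set_scope.
Local Open Scope ring_scope.

(** * Elementary inequalities for the estimator as a function of three numbers *)

Section mom3.
Context {F : realFieldType}.
Implicit Types (x y z u v : F).

(* [disp3] is 9 times the sample variance, so [mom3] is the estimator. *)
Definition disp3 x y z : F := (x - y) ^+ 2 + (y - z) ^+ 2 + (z - x) ^+ 2.

Definition mom3 x y z : F := (x + y + z) ^+ 2 / disp3 x y z.

Lemma disp3_ge0 x y z : 0 <= disp3 x y z.
Proof. by rewrite /disp3 !addr_ge0 ?sqr_ge0. Qed.

Lemma mom3_perm213 x y z : mom3 x y z = mom3 y x z.
Proof. by rewrite /mom3 /disp3; congr (_ / _); ring. Qed.

Lemma mom3_perm312 x y z : mom3 x y z = mom3 z x y.
Proof. by rewrite /mom3 /disp3; congr (_ / _); ring. Qed.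

(** When the dispersion vanishes, division by zero gives [mom3] the value 0, which [0 <= u]
    excludes. *)
Lemma mom3_gtP u x y z : 0 <= u -> u < mom3 x y z ->
  0 < disp3 x y z /\ u * disp3 x y z < (x + y + z) ^+ 2.
Proof.
move=> u0; have [D0|D_n0] := eqVneq (disp3 x y z) 0.
  by rewrite /mom3 D0 invr0 mulr0 ltNge u0.
have D0 : 0 < disp3 x y z by rewrite lt_neqAle eq_sym D_n0 disp3_ge0.
by rewrite /mom3 ltr_pdivlMr.
Qed.

Lemma mom3_le u x y z : 0 < disp3 x y z ->
  (mom3 x y z <= u) = ((x + y + z) ^+ 2 <= u * disp3 x y z).
Proof. by move=> D0; rewrite /mom3 ler_pdivrMr. Qed.

Lemma mom3_gt u x y z : 0 < disp3 x y z ->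
  (u < mom3 x y z) = (u * disp3 x y z < (x + y + z) ^+ 2).
Proof. by move=> D0; rewrite /mom3 ltr_pdivlMr. Qed.

(** If [x] exceeded both [10 * y] and [10 * z], the squared sum would be below 1.44 x^2 and the
    dispersion above 2 (0.9 x)^2 = 1.62 x^2. *)
Lemma mom3_gt1_max x y z : 0 < y -> 0 < z -> y <= x -> z <= x ->
  1 < mom3 x y z -> x <= 10 * y \/ x <= 10 * z.
Proof.
move=> y0 z0 yx zx /(mom3_gtP _ _ _ _ ler01)[_]; rewrite mul1r /disp3 => H.
have [?|xy] := leP x (10 * y); first by left.
have [?|xz] := leP x (10 * z); first by right.
exfalso; nra.
Qed.

Lemma mom3_gt1 x y z : 0 < x -> 0 < y -> 0 < z -> 1 < mom3 x y z ->
  [\/ y / 10 <= x <= 10 * y, z / 10 <= x <= 10 * z | z / 10 <= y <= 10 * z].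
Proof.
move=> x0 y0 z0 m1.
have [xy|yx] := leP x y; last have [xz|zx] := leP x z.
- have [yz|zy] := leP y z.
  + have := m1; rewrite mom3_perm312 => /(mom3_gt1_max _ _ _ x0 y0).
    case; [lra|lra|move=> ?; apply: Or32; lra|move=> ?; apply: Or33; lra].
  + have := m1; rewrite mom3_perm213 => /(mom3_gt1_max _ _ _ x0 z0).
    case; [lra|lra|move=> ?; apply: Or31; lra|move=> ?; apply: Or33; lra].
- have := m1; rewrite mom3_perm312 => /(mom3_gt1_max _ _ _ x0 y0).
  case; [lra|lra|move=> ?; apply: Or32; lra|move=> ?; apply: Or33; lra].
- have := m1 => /(mom3_gt1_max _ _ _ y0 z0).
  case; [lra|lra|move=> ?; apply: Or31; lra|move=> ?; apply: Or32; lra].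
Qed.

(** Twice the squared sum minus the dispersion is 6 (xy + yz + zx) > 0, so a value at most 1/2 can
    only be the default 0 of a vanishing dispersion. *)
Lemma mom3_le_half x y z : 0 < x -> 0 < y -> 0 < z ->
  mom3 x y z <= 2^-1 -> x = y.
Proof.
move=> x0 y0 z0; have [D0 _|D_n0] := eqVneq (disp3 x y z) 0.
  apply/eqP; rewrite -subr_eq0 -sqrf_eq0; move/eqP: D0; rewrite /disp3.
  rewrite paddr_eq0 ?addr_ge0 ?sqr_ge0// paddr_eq0 ?sqr_ge0// -andbA.
  by case/and3P.
have D0 : 0 < disp3 x y z by rewrite lt_neqAle eq_sym D_n0 disp3_ge0.
rewrite mom3_le// /disp3 => H; exfalso.
have := mulr_gt0 x0 y0; have := mulr_gt0 y0 z0; have := mulr_gt0 x0 z0.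
nra.
Qed.

(** The estimator is a decreasing function of the ratio (z^2 + b^2 + c^2) / (z + b + c)^2. Where the
    estimator lies in []u, v]], this ratio grows with [z] at a rate bounded below, so that such [z]
    span a relative length of order [v - u]. *)
Lemma mom3_slice e u v b c z1 z2 : 0 < e -> 2^-1 + e <= u -> u <= v -> v <= 1 ->
  0 < b -> 0 < c -> b <= z1 -> c <= z1 -> z1 <= z2 ->
  (z1 + b + c) ^+ 2 <= v * disp3 z1 b c ->
  u * disp3 z2 b c < (z2 + b + c) ^+ 2 ->
  z2 - z1 <= 14 / e * (v - u) * z1.
Proof.
move=> e0 ue uv v1 b0 c0 bz cz z12 H1 H2.
set s := b + c; set r := b ^+ 2 + c ^+ 2.
have s0 : 0 < s by rewrite addr_gt0.
have rs : r <= s ^+ 2 by rewrite /r /s; nra.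
have r0 : 0 < r by rewrite /r; nra.
have z1s : s <= 2 * z1 by rewrite /s; lra.
set T1 := z1 + s; set T2 := z2 + s.
set Q1 := z1 ^+ 2 + r; set Q2 := z2 ^+ 2 + r.
(* The dispersion is 3 Q - T^2, so both hypotheses become bounds on Q / T^2: at least (1 + v) / (3
   v) at [z1], less than (1 + u) / (3 u) at [z2]. *)
have {}H1 : (1 + v) * T1 ^+ 2 <= 3 * v * Q1.
  by move: H1; rewrite /disp3 /T1 /Q1 /s /r; lra.
have {}H2 : 3 * u * Q2 < (1 + u) * T2 ^+ 2.
  by move: H2; rewrite /disp3 /T2 /Q2 /s /r; lra.
have T1z : 0 < T1 by rewrite /T1; lra.
have T2z : 0 < T2 by rewrite /T2; lra.
have Q10 : 0 < Q1 by rewrite /Q1; nra.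
(* Since [v <= 1], the ratio at [z1] is at least 2/3, which fails for [z1] between [s / 2] and
   [2 * s]. *)
have z1ge : 2 * s <= z1.
  rewrite leNgt; apply/negP => z1lt.
  have : 2 * T1 ^+ 2 <= 3 * Q1.
    have T10 : 0 <= T1 ^+ 2 by rewrite sqr_ge0.
    have v0 : 0 < v by lra.
    rewrite -(ler_pM2l v0).
    have : 0 <= (1 - v) * T1 ^+ 2 by rewrite mulr_ge0// subr_ge0.
    lra.
  rewrite /T1 /Q1 => H.
  have : 0 <= (2 * z1 - s) * (2 * s - z1) by rewrite mulr_ge0// subr_ge0// ltW.
  nra.
(* The ratio tends to 1, and flattens, as [z] grows. Here [u >= 1/2 + e] keeps it below 1 - 2e/3 at
   [z2], so [s] is not negligible against [z2]; this is the source of the factor [1 / e]. *)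
have sz2 : e / 3 * z2 <= s.
  rewrite leNgt; apply/negP => slt.
  have Q2T : 3 * Q2 <= (3 - 2 * e) * T2 ^+ 2.
    have T20 : 0 <= T2 ^+ 2 by rewrite sqr_ge0.
    have u0 : 0 < u by lra.
    rewrite -(ler_pM2l u0).
    have u1 : 1 <= u * (2 - 2 * e) by nra.
    have : 0 <= (u * (2 - 2 * e) - 1) * T2 ^+ 2 by rewrite mulr_ge0// subr_ge0.
    lra.
  have T2lt : T2 ^+ 2 < (z2 * (1 + e / 3)) ^+ 2.
    have : T2 < z2 * (1 + e / 3) by rewrite /T2; lra.
    nra.
  have e12 : e <= 2^-1 by lra.
  have : 0 < z2 ^+ 2 by rewrite exprn_gt0//; lra.
  have : 3 * z2 ^+ 2 <= 3 * Q2 by rewrite /Q2; lra.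
  rewrite exprMn in T2lt.
  nra.
(* [Q2 / T2 ^+ 2 - Q1 / T1 ^+ 2] is at least of order
   [(z2 - z1) * s / (z1 * z2)] by [main], and at most [4 / 3 * (v - u)]
   by [upper]. *)
have main : (z2 - z1) * (3 / 2 * s * z1 * z2) <= Q2 * T1 ^+ 2 - Q1 * T2 ^+ 2.
  have -> : Q2 * T1 ^+ 2 - Q1 * T2 ^+ 2 =
      (z2 - z1) * (2 * s * z1 * z2 + (s ^+ 2 - r) * (z1 + z2) - 2 * r * s).
    by rewrite /Q2 /Q1 /T1 /T2; ring.
  rewrite ler_wpM2l ?subr_ge0//.
  have : r * 4 <= z1 * z2 by nra.
  have : 0 <= (s ^+ 2 - r) * (z1 + z2) by rewrite mulr_ge0 ?subr_ge0//; lra.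
  nra.
have upper : Q2 * T1 ^+ 2 - Q1 * T2 ^+ 2 <=
    4 / 3 * (v - u) * (T1 ^+ 2 * T2 ^+ 2).
  have T10 : 0 < T1 ^+ 2 by rewrite exprn_gt0.
  have T20 : 0 < T2 ^+ 2 by rewrite exprn_gt0.
  have u0 : 0 < u by lra.
  have v0 : 0 < v by lra.
  have a1 : Q2 * T1 ^+ 2 <= (1 + u) / (3 * u) * (T1 ^+ 2 * T2 ^+ 2).
    rewrite mulrAC ler_pdivlMr; last by lra.
    nra.
  have a2 : (1 + v) / (3 * v) * (T1 ^+ 2 * T2 ^+ 2) <= Q1 * T2 ^+ 2.
    rewrite mulrAC ler_pdivrMr; last by lra.
    nra.
  apply: (@le_trans _ _
     (((1 + u) / (3 * u) - (1 + v) / (3 * v)) * (T1 ^+ 2 * T2 ^+ 2))).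
    by rewrite mulrBl; lra.
  rewrite ler_wpM2r//; first by rewrite mulr_ge0// ltW.
  have -> : (1 + u) / (3 * u) - (1 + v) / (3 * v) = (v - u) / (3 * (u * v)).
    by field; rewrite !gt_eqF.
  rewrite ler_pdivrMr; last by nra.
  have : 4^-1 <= u * v by nra.
  nra.
have TT : T1 ^+ 2 * T2 ^+ 2 <= 81 / 16 * (z1 * z2) ^+ 2.
  have h1 : T1 <= 3 / 2 * z1 by rewrite /T1; lra.
  have h2 : T2 <= 3 / 2 * z2 by rewrite /T2; lra.
  have -> : 81 / 16 * (z1 * z2) ^+ 2 = ((3 / 2 * z1) * (3 / 2 * z2)) ^+ 2 :> F.
    by field.
  rewrite -exprMn; apply: lerXn2r; rewrite ?nnegrE; [nra|nra|].
  by apply: ler_pM => //; apply: ltW.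
have z10 : 0 < z1 by lra.
have z20 : 0 < z2 by lra.
have zz : 0 < z1 * z2 by rewrite mulr_gt0.
have fin : (z2 - z1) * (3 / 2 * s) <= 27 / 4 * (v - u) * (z1 * z2).
  rewrite -(ler_pM2r zz).
  apply: (le_trans (le_trans _ (le_trans main upper))); first by lra.
  have : 4 / 3 * (v - u) * (T1 ^+ 2 * T2 ^+ 2) <=
         4 / 3 * (v - u) * (81 / 16 * (z1 * z2) ^+ 2).
    by rewrite ler_wpM2l//; lra.
  lra.
have : (z2 - z1) * (e / 2) <= 27 / 4 * (v - u) * z1.
  rewrite -(ler_pM2r z20).
  have : (z2 - z1) * (3 / 2 * (e / 3 * z2)) <= (z2 - z1) * (3 / 2 * s).
    by rewrite ler_wpM2l ?subr_ge0//; lra.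
  lra.
move=> H.
rewrite -(ler_pM2r e0).
have -> : 14 / e * (v - u) * z1 * e = 14 * (v - u) * z1.
  by field; rewrite gt_eqF.
have : 0 <= (v - u) * z1 by rewrite mulr_ge0// ?subr_ge0// ltW.
lra.
Qed.

(* [w = 2 * sqrt (b * c)]: at [x = b + c + w], that is, when [sqrt x] is
   [sqrt b + sqrt c], the estimator is 2. *)
Lemma mom3_steep p h b c w x : 0 < p -> p <= 1 -> 0 < h -> h <= p ^+ 4 ->
  1 <= b <= 2 -> 0 < c <= p ^+ 4 -> 0 <= w -> w ^+ 2 = 4 * (b * c) ->
  b + c + w <= x <= b + c + w + h / (48 * p ^+ 2) ->
  [/\ x <= 7, 0 < disp3 x b c, (x + b + c) ^+ 2 <= 2 * disp3 x b c &
     (2 - h) * disp3 x b c < (x + b + c) ^+ 2].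
Proof.
move=> p0 p1 h0 hp /andP[b1 b2] /andP[c0 cp] w0 wE /andP[xl xu].
have p20 : 0 < p ^+ 2 by rewrite exprn_gt0.
have p21 : p ^+ 2 <= 1 by rewrite exprn_ile1// ltW.
have p4E : p ^+ 4 = p ^+ 2 * p ^+ 2 by ring.
(* From [4 * (b * c) <= 8 * p ^+ 4]. The estimator leaves the value 2 with a slope of order [w], so
   a small [p] allows a window for [x] of length of order h / p^2. *)
have w3 : w <= 3 * p ^+ 2.
  have p4 : 0 < p ^+ 4 by rewrite exprn_gt0.
  have : w ^+ 2 <= (3 * p ^+ 2) ^+ 2 by rewrite wE exprMn -exprM; nra.
  by rewrite ler_pXn2r ?nnegrE//; lra.
set k := h / (48 * p ^+ 2) in xu.
have kE : k * p ^+ 2 = h / 48 by rewrite /k; field; rewrite gt_eqF.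
have k1 : k <= p ^+ 2 / 48.
  rewrite /k ler_pdivrMr; last by lra.
  lra.
have k0 : 0 <= k by rewrite /k divr_ge0// ltW//; lra.
set t := x - (b + c + w).
have t0 : 0 <= t by rewrite /t; lra.
have tk : t <= k by rewrite /t; lra.
have Eb : t * (2 * w + t) <= 7 / 48 * h.
  have -> : 7 / 48 * h = k * (7 * p ^+ 2) by lra.
  by apply: ler_pM => //; lra.
have xE : x = b + c + w + t by rewrite /t; ring.
have c1 : c <= 1 by nra.
(* Twice the dispersion minus the squared sum is 3 ((x - b - c)^2 - 4bc), which measures the
   distance of the estimator from 2. *)
have DE : 2 * disp3 x b c = (x + b + c) ^+ 2 + 3 * (t * (2 * w + t)).
  have -> : t * (2 * w + t) = (x - b - c) ^+ 2 - w ^+ 2 by rewrite /t; ring.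
  by rewrite wE /disp3; ring.
have T4 : 4 <= (x + b + c) ^+ 2.
  have T2 : 2 <= x + b + c by lra.
  nra.
have tt : 0 <= t * (2 * w + t) by rewrite mulr_ge0//; lra.
split; [lra|lra|lra|nra].
Qed.

Lemma mom3_box x y z : 1 <= x <= 11 / 10 -> 12 / 10 <= y <= 13 / 10 ->
  14 / 10 <= z <= 15 / 10 -> 2 < mom3 x y z.
Proof.
move=> /andP[? ?] /andP[? ?] /andP[? ?]; rewrite mom3_gt /disp3; nra.
Qed.

End mom3.

(** * Bounds on the gamma density, on interval probabilities and on the Gamma function *)

Section gamma_law.
Context {R : realType}.
Implicit Types (a l u v : R).

Lemma Gamma_ge0 a : 0 <= Gamma a.
Proof.
apply: fine_ge0; apply: integral_ge0 => x _.
by rewrite lee_fin mulr_ge0 ?powR_ge0 ?expR_ge0.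
Qed.

Lemma gamma_pdf_pos a l u : 0 < u ->
  gamma_pdf a l u = (Gamma a * l `^ a)^-1 * u `^ (a - 1) * expR (- (u / l)).
Proof. by move=> u0; rewrite /gamma_pdf patchE mem_set//= in_itv/= u0. Qed.

Lemma gamma_pdf_ge0 a l u : 0 <= gamma_pdf a l u.
Proof.
rewrite /gamma_pdf patchE; case: ifP => // _.
by rewrite !mulr_ge0 ?invr_ge0 ?mulr_ge0 ?powR_ge0 ?expR_ge0 ?Gamma_ge0.
Qed.

Lemma measurable_gamma_pdf a l : measurable_fun [set: R] (gamma_pdf a l).
Proof.
apply/(measurable_restrictT _ _).1 => //.
apply: measurable_funTS; apply: measurable_funM.
  by apply: measurable_funM => //; exact: measurable_powR.
apply: measurableT_comp => //; apply: measurableT_comp => //.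
exact: measurable_funM.
Qed.

Lemma ler_powRN a u v : 0 <= a -> 0 < u -> u <= v -> v `^ (- a) <= u `^ (- a).
Proof.
move=> a0 u0 uv; have v0 : 0 < v by apply: lt_le_trans uv.
rewrite !powRN lef_pV2 ?posrE ?powR_gt0//.
by apply: ge0_ler_powR; rewrite ?nnegrE// ltW.
Qed.

Lemma gamma_pdf_nonincreasing a l u v : a <= 1 -> 0 < l -> 0 < u -> u <= v ->
  gamma_pdf a l v <= gamma_pdf a l u.
Proof.
move=> a1 l0 u0 uv; have v0 : 0 < v by apply: lt_le_trans uv.
rewrite !gamma_pdf_pos//; apply: ler_pM.
- by rewrite mulr_ge0 ?invr_ge0 ?mulr_ge0 ?powR_ge0 ?Gamma_ge0.
- exact: expR_ge0.
- rewrite ler_wpM2l ?invr_ge0 ?mulr_ge0 ?powR_ge0 ?Gamma_ge0//.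
  by rewrite -opprB; apply: ler_powRN => //; rewrite subr_ge0.
- by rewrite ler_expR lerN2 ler_pM2r// invr_gt0.
Qed.

(** The density with respect to du / u; it depends on [u] and [l] only through [u / l]. *)
Lemma mulr_gamma_pdf a l u : 0 < a -> 0 < l -> 0 < u ->
  u * gamma_pdf a l u = (u / l) `^ a * expR (- (u / l)) / Gamma a.
Proof.
move=> a0 l0 u0; rewrite gamma_pdf_pos// invfM.
have uE : u `^ a = (u / l) `^ a * l `^ a.
  by rewrite -powRM ?divfK ?gt_eqF// ?ltW ?divr_gt0.
transitivity
  ((Gamma a)^-1 * (l `^ a)^-1 * (u * u `^ (a - 1)) * expR (- (u / l))).
  by ring.
rewrite mulr_powRB1 ?(ltW u0)// uE; set g := (Gamma a)^-1.
by field; rewrite gt_eqF// powR_gt0.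
Qed.

(** With y = u / l, the power y^a is at most 1 if y <= 1 and at most y otherwise, hence at most e^y
    in both cases. *)
Lemma mulr_gamma_pdf_le a l u : 0 < a -> a <= 1 -> 0 < l -> 0 < u ->
  u * gamma_pdf a l u <= (Gamma a)^-1.
Proof.
move=> a0 a1 l0 u0; rewrite mulr_gamma_pdf//.
rewrite ler_piMl ?invr_ge0 ?Gamma_ge0//.
set y := u / l; have y0 : 0 < y by rewrite divr_gt0.
rewrite expRN ler_pdivrMr ?expR_gt0// mul1r.
have [y1|y1] := leP y 1.
  apply: (@le_trans _ _ 1); last by rewrite -expR0 ler_expR ltW.
  have := ge0_ler_powR (ltW a0) (_ : y \in Num.nneg) (_ : 1 \in Num.nneg) y1.
  by rewrite powR1; apply; rewrite nnegrE// ltW.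
apply: le_trans (ler1_powR (ltW y1) a1) _.
by apply: le_trans (expR_ge1Dx y); rewrite lerDr.
Qed.

Lemma lebesgue_measure_itvoc u v : u <= v ->
  lebesgue_measure `]u, v]%classic = (v - u)%:E.
Proof.
move=> uv; rewrite lebesgue_measure_itv/= lte_fin lt_neqAle uv andbT.
by case: eqVneq => [->|_]; rewrite ?subrr -?EFinD.
Qed.

Lemma lebesgue_measure_itvcc u v : u <= v ->
  lebesgue_measure `[u, v]%classic = (v - u)%:E.
Proof.
move=> uv; rewrite lebesgue_measure_itv/= lte_fin lt_neqAle uv andbT.
by case: eqVneq => [->|_]; rewrite ?subrr -?EFinD.
Qed.

Section sample.
Context {d} {T : measurableType d} {P : probability T R} {X : {RV P >-> R}}.
Context {a l : R}.
Hypotheses (a0 : 0 < a) (a1 : a <= 1) (l0 : 0 < l).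
Hypothesis gX : gamma_distributed a l X.

Lemma gamma_le0 : distribution P X `]-oo, 0] = 0%E.
Proof.
rewrite gX//; apply: integral0_eq => x; rewrite /= in_itv/= => x0.
rewrite /gamma_pdf patchE; case: ifPn => //; rewrite inE/= in_itv/= andbT.
by rewrite ltNge x0.
Qed.

(* Were [Gamma a] zero, [gamma_pdf] would be the zero function. *)
Lemma Gamma_gt0 : 0 < Gamma a.
Proof.
rewrite lt_neqAle Gamma_ge0 andbT eq_sym; apply/eqP => G0.
have := gX _ measurableT.
rewrite probability_setT integral0_eq => [/eqP|x _].
  by rewrite eqe oner_eq0.
by rewrite /gamma_pdf patchE; case: ifP => // _; rewrite G0 mul0r invr0 !mul0r.
Qed.

Lemma gamma_pdf_gt0 u : 0 < u -> 0 < gamma_pdf a l u.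
Proof.
move=> u0; rewrite gamma_pdf_pos// !mulr_gt0// ?expR_gt0 ?powR_gt0//.
by rewrite invr_gt0 mulr_gt0// ?powR_gt0// Gamma_gt0.
Qed.

Lemma gamma_itv_ge u v : 0 <= u -> u <= v ->
  (((v - u) * gamma_pdf a l v)%:E <= distribution P X `]u, v])%E.
Proof.
move=> u0 uv; rewrite gX//.
have -> : ((v - u) * gamma_pdf a l v)%:E =
    (\int[lebesgue_measure]_(x in `]u, v]) (cst (gamma_pdf a l v)%:E x))%E.
  rewrite integral_cst// mulrC EFinM; congr (_ * _)%E.
  exact/esym/lebesgue_measure_itvoc.
apply: ge0_le_integral => //.
- by move=> x _; rewrite lee_fin gamma_pdf_ge0.
- apply/measurable_EFinP; apply: measurable_funTS; exact: measurable_gamma_pdf.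
- move=> x /=; rewrite in_itv/= => /andP[ux xv]; rewrite lee_fin.
  by apply: gamma_pdf_nonincreasing => //; apply: le_lt_trans ux.
Qed.

Lemma gamma_itvcc_le u v : 0 < u -> u <= v ->
  (distribution P X `[u, v] <= ((v - u) * gamma_pdf a l u)%:E)%E.
Proof.
move=> u0 uv; rewrite gX//.
have -> : ((v - u) * gamma_pdf a l u)%:E =
    (\int[lebesgue_measure]_(x in `[u, v]) (cst (gamma_pdf a l u)%:E x))%E.
  rewrite integral_cst// mulrC EFinM; congr (_ * _)%E.
  exact/esym/lebesgue_measure_itvcc.
apply: ge0_le_integral => //.
- by move=> x _; rewrite lee_fin gamma_pdf_ge0.
- apply/measurable_EFinP; apply: measurable_funTS; exact: measurable_gamma_pdf.
- move=> x /=; rewrite in_itv/= => /andP[ux xv]; rewrite lee_fin.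
  by apply: gamma_pdf_nonincreasing.
Qed.

(** The bound depends on the relative length [k] alone, so it stays uniform as [u] tends to 0, where
    the density may blow up. *)
Lemma gamma_itvcc_relative_le u (k : R) : 0 < u -> 0 <= k ->
  (distribution P X `[u, (u + k * u)%R] <= (k / Gamma a)%:E)%E.
Proof.
move=> u0 k0; apply: le_trans (gamma_itvcc_le _ _ u0 _) _.
  by rewrite lerDl mulr_ge0// ltW.
rewrite lee_fin addrAC subrr add0r -mulrA ler_wpM2l// mulr_gamma_pdf_le//.
Qed.

End sample.

(* The intervals ]l / 2^(k+1), l / 2^k] with k <= n have probability at least
   c / Gamma(1/(n+1)) for an absolute constant c; their total is at most 1. *)
Lemma Gamma_inv_nat_ge l n d (T : measurableType d) (P : probability T R)
    (X : {RV P >-> R}) : 0 < l -> gamma_distributed n.+1%:R^-1 l X ->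
  n.+1%:R / (4 * expR 1) <= Gamma (n.+1%:R^-1 : R).
Proof.
move=> l0 gX; set a := n.+1%:R^-1.
have a0 : 0 < a by rewrite invr_gt0.
have a1 : a <= 1 by rewrite invf_le1// ler1n.
have G0 : 0 < Gamma a := Gamma_gt0 gX.
pose c := (4 * expR 1 * Gamma a)^-1.
have dyadic k : (k <= n)%N ->
    (c%:E <= distribution P X `](l / 2 ^+ k.+1)%R, (l / 2 ^+ k)%R])%E.
  move=> kn; apply: le_trans (gamma_itv_ge a1 l0 gX _ _ _ _).
  - have q0 : 0 < 2 ^+ k :> R by rewrite exprn_gt0.
    have -> : (l / 2 ^+ k - l / 2 ^+ k.+1) * gamma_pdf a l (l / 2 ^+ k) =
        2^-1 * (l / 2 ^+ k * gamma_pdf a l (l / 2 ^+ k)).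
      by rewrite exprS; field; rewrite gt_eqF.
    rewrite mulr_gamma_pdf ?divr_gt0//.
    have -> : l / 2 ^+ k / l = (2 ^+ k)^-1
      by rewrite mulrAC divff ?gt_eqF// mul1r.
    rewrite lee_fin /c invfM mulrA ler_pM2r ?invr_gt0//.
    have -> : (4 * expR 1)^-1 = 2^-1 * (2^-1 * expR (- 1)) :> R.
      by rewrite expRN; field; rewrite gt_eqF ?expR_gt0.
    rewrite ler_pM2l ?invr_gt0//.
    apply: ler_pM => //; rewrite ?expR_ge0//; last first.
      by rewrite ler_expR lerN2 invf_le1// exprn_ege1// ler1n.
    (* Since [k <= n] and [a] is 1/(n+1), the power 2^(-ka) is at least 1/2. *)
    rewrite -powR_invn// -powRrM -powR_inv1//.
    apply: ler_powR; first by rewrite ler1n.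
    by rewrite mulNr lerN2 ler_pdivrMr// mul1r ler_nat ltnW.
  - by rewrite ltW// divr_gt0// exprn_gt0.
  - by rewrite ler_pM2l// lef_pV2 ?posrE ?exprn_gt0// ler_weXn2l// ler1n.
have c0 : 0 < c by rewrite invr_gt0 !mulr_gt0// expR_gt0.
have tele k : (k <= n.+1)%N ->
    ((k%:R * c)%:E <= distribution P X `](l / 2 ^+ k)%R, l])%E.
  elim: k => [_|k IH kn]; first by rewrite mul0r.
  have -> : `]l / 2 ^+ k.+1, l]%classic =
      `]l / 2 ^+ k.+1, l / 2 ^+ k]%classic `|` `]l / 2 ^+ k, l]%classic.
    have q0 : 0 < 2 ^+ k :> R by rewrite exprn_gt0.
    apply: itv_bndbnd_setU; rewrite bnd_simp.
      by rewrite ler_pM2l// lef_pV2 ?posrE ?exprn_gt0// ler_weXn2l// ler1n.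
    by rewrite ler_pdivrMr// ler_peMr ?exprn_ege1 ?ler1n// ltW.
  rewrite measureU//; last first.
    apply/seteqP; split => // x [] /=; rewrite !in_itv/= => /andP[_ H] /andP[].
    by rewrite ltNge H.
  rewrite mulrSr mulrDl mul1r EFinD addeC leeD ?dyadic// IH//.
  exact: ltnW.
have := tele n.+1 (leqnn _) => /le_trans/(_ (probability_le1 _ _)).
rewrite lee_fin /c ler_pdivrMr ?mul1r ?mulr_gt0 ?expR_gt0// => H.
by rewrite ler_pdivrMr ?mulr_gt0 ?expR_gt0// mulrC H.
Qed.

End gamma_law.

(** * Conditioning on two of three independent variables *)

Section independent_triple.
Context {R : realType} {d : measure_display} {T : measurableType d}.
Context {P : probability T R}.

Definition independent3 (Y1 Y2 Y3 : {RV P >-> R}) : Prop :=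
  forall A B C : set R, measurable A -> measurable B -> measurable C ->
    P ((Y1 @^-1` A `&` Y2 @^-1` B) `&` Y3 @^-1` C) =
    (P (Y1 @^-1` A) * P (Y2 @^-1` B) * P (Y3 @^-1` C))%E.

Lemma mutually_independent3 (X : 'I_3 -> {RV P >-> R}) (i j k : 'I_3) :
  mutually_independent X -> i != j -> i != k -> j != k ->
  independent3 (X i) (X j) (X k).
Proof.
move=> iX ij ik jk A B C mA mB mC.
have mE m : [|| m == i, m == j | m == k].
  by move: i j k m ij ik jk {iX}; do 4![case; do 3?[case=> //] => ?].
pose S m := if m == i then A else if m == j then B else C.
have mS m : measurable (S m) by rewrite /S; case: ifP => // _; case: ifP.
have Si : S i = A by rewrite /S eqxx.
have Sj : S j = B by rewrite /S eq_sym (negbTE ij) eqxx.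
have Sk : S k = C by rewrite /S !(eq_sym k) (negbTE ik) (negbTE jk).
transitivity (P (\bigcap_(m in [set: 'I_3]) (X m @^-1` S m))).
  congr (P _); apply/seteqP; split => t.
    move=> [[Ai Bj] Ck] m _; have /or3P[] := mE m => /eqP ->.
    - by rewrite Si.
    - by rewrite Sj.
    - by rewrite Sk.
  move=> H; rewrite -Si -Sj -Sk; split; [split|]; exact: H.
rewrite (iX _ mS) (bigD1 i)//= (bigD1 j) 1?eq_sym//= (big_pred1 k); last first.
  move=> m /=; have /or3P[] := mE m => /eqP ->; rewrite ?eqxx ?andbF//=.
  - by rewrite (negbTE ik).
  - by rewrite (negbTE jk).
  - by rewrite !(eq_sym k) ik jk.
by rewrite Si Sj Sk muleA.
Qed.

Context {Y1 Y2 Y3 : {RV P >-> R}}.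
Hypothesis iY : independent3 Y1 Y2 Y3.

(** For fixed [C] both sides are finite measures in [A]. They agree on rectangles, a generating
    class closed under intersection, hence everywhere. *)
Lemma independent3_pair (A : set (R * R)) (C : set R) :
  measurable A -> measurable C ->
  P ((fun t => (Y1 t, Y2 t)) @^-1` A `&` Y3 @^-1` C) =
  (P ((fun t => (Y1 t, Y2 t)) @^-1` A) * P (Y3 @^-1` C))%E.
Proof.
move=> mA mC; set W := fun t => (Y1 t, Y2 t).
have mW : measurable_fun [set: T] W by exact: measurable_fun_pair.
have mD : measurable (Y3 @^-1` C) by exact: measurable_funPTI.
have c0 : 0 <= fine (P (Y3 @^-1` C)) by rewrite fine_ge0.
pose m1 := measure_function_pushforward__canonical__measure_function_Measure
  (mrestr P mD) mW.
pose m2 := mscale (NngNum c0)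
  (measure_function_pushforward__canonical__measure_function_Measure P mW).
have m2E E : m2 E = (P (Y3 @^-1` C) * P (W @^-1` E))%E.
  by rewrite -[X in (X * _)%E]fineK// fin_num_measure.
rewrite -[LHS]/(m1 A) muleC -m2E.
pose G : set (set (R * R)) :=
  [set E | exists A1 A2, [/\ measurable A1, measurable A2 & E = A1 `*` A2]].
apply: (@measure_unique _ _ _ G (fun=> setT)) => //.
- rewrite measurable_prod_measurableType; congr (<<s _ >>).
  apply/seteqP; split => [_ [A1 mA1 [A2 mA2 <-]]|_ [A1 [A2 [mA1 mA2 ->]]]].
    by exists A1, A2.
  by exists A1 => //; exists A2.
- move=> _ _ [A1 [A2 [mA1 mA2 ->]]] [B1 [B2 [mB1 mB2 ->]]].
  exists (A1 `&` B1), (A2 `&` B2); rewrite setXI.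
  by split => //; exact: measurableI.
- by move=> _; exists setT, setT; rewrite setXTT.
- by rewrite bigcup_const.
- move=> _ [A1 [A2 [mA1 mA2 ->]]].
  rewrite -[RHS]/(m2 (A1 `*` A2)) m2E.
  rewrite -[LHS]/(P (W @^-1` (A1 `*` A2) `&` Y3 @^-1` C)).
  have -> : W @^-1` (A1 `*` A2) = Y1 @^-1` A1 `&` Y2 @^-1` A2 by [].
  rewrite iY//.
  have := iY _ _ _ mA1 mA2 measurableT.
  by rewrite preimage_setT setIT probability_setT mule1 => ->; rewrite muleC.
- by move=> _; rewrite -ge0_fin_numE// fin_num_measure// preimage_setT.
Qed.

(** By uniqueness of the product measure, the law of the triple is the product of the law of the
    pair and that of [Y3]. *)
Lemma independent3_fubini (B : set (R * R * R)) : measurable B ->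
  P [set t | B ((Y1 t, Y2 t), Y3 t)] =
  (\int[P]_t distribution P Y3 (xsection B (Y1 t, Y2 t)))%E.
Proof.
move=> mB; pose W := fun t => (Y1 t, Y2 t).
have mW : measurable_fun [set: T] W by exact: measurable_fun_pair.
pose V := fun t => (W t, Y3 t).
have mV : measurable_fun [set: T] V by exact: measurable_fun_pair.
pose Wm : {mfun T >-> (R * R)%type} :=
  HB.pack W (isMeasurableFun.Build _ _ _ _ W mW).
pose Vm : {mfun T >-> (R * R * R)%type} :=
  HB.pack V (isMeasurableFun.Build _ _ _ _ V mV).
rewrite -[LHS]/(distribution P Vm B).
rewrite -(@product_measure_unique _ _ _ _ _ (distribution P Wm)
  (distribution P Y3) (distribution P Vm))//; last first.
  by move=> A C mA mC; exact: independent3_pair.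
rewrite /product_measure1 (ge0_integral_distribution Wm)//.
exact: measurable_fun_xsection.

Qed.

(** Sections at nonpositive [b] or [c] contribute nothing, as they belong to a null event. *)
Lemma independent3_le (B : set (R * R * R)) (k : R) : measurable B ->
  P [set t | 0 < Y1 t] = 1%E -> P [set t | 0 < Y2 t] = 1%E -> 0 <= k ->
  (forall b c, 0 < b -> 0 < c ->
     (distribution P Y3 [set x | B ((b, c), x)] <= k%:E)%E) ->
  (P [set t | B ((Y1 t, Y2 t), Y3 t)] <= k%:E)%E.
Proof.
move=> mB Y10 Y20 k0 kP; rewrite independent3_fubini//.
have m0 (Y : {RV P >-> R}) : measurable [set t | 0 < Y t].
  rewrite (_ : [set t | _] = Y @^-1` `]0, +oo[); first exact: measurable_funPTI.
  by apply/seteqP; split => t; rewrite /= in_itv/= andbT.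
have n1 (Y : {RV P >-> R}) :
    P [set t | 0 < Y t] = 1%E -> P (~` [set t | 0 < Y t]) = 0%E.
  by move=> Y1E; rewrite probability_setC// Y1E subee.
have -> : k%:E = (\int[P]_t (cst k%:E t))%E.
  rewrite integral_cst// -[LHS]mule1; congr (_ * _)%E.
  exact/esym/probability_setT.
apply: ae_ge0_le_integral => //.
- apply: (@measurableT_comp _ _ _ _ _ _
    (fun w => distribution P Y3 (xsection B w)) _ (fun t => (Y1 t, Y2 t))).
    exact: measurable_fun_xsection.
  exact: measurable_fun_pair.
- exists (~` [set t | 0 < Y1 t] `|` ~` [set t | 0 < Y2 t]); split.
  + by apply: measurableU; exact: measurableC.
  + apply/eqP; rewrite -measure_le0.
    apply: le_trans (measureU2 _ _ _) _; [exact: measurableC..|].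
    by rewrite [X in (X + _)%E]n1// [X in (_ + X)%E]n1// adde0.
  + move=> t /= /not_implyP[_ H]; apply/not_andP => -[y1 y2]; apply: H.
    by have := kP _ _ y1 y2; rewrite xsectionE.
Qed.

(** The integral of the section probabilities is restricted to the event that [Y1] is in [D1] and
    [Y2] in [D2]. *)
Lemma independent3_ge (B : set (R * R * R)) (D1 D2 : set R) (k : R) :
  measurable B -> measurable D1 -> measurable D2 -> 0 <= k ->
  (forall b c, D1 b -> D2 c ->
     (k%:E <= distribution P Y3 [set x | B ((b, c), x)])%E) ->
  (k%:E * (distribution P Y1 D1 * distribution P Y2 D2) <=
     P [set t | B ((Y1 t, Y2 t), Y3 t)])%E.
Proof.
move=> mB m1 m2 k0 kP; rewrite independent3_fubini//.
set D := Y1 @^-1` D1 `&` Y2 @^-1` D2.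
have mD : measurable D by apply: measurableI; exact: measurable_funPTI.
have -> : (distribution P Y1 D1 * distribution P Y2 D2)%E = P D.
  have := iY _ _ _ m1 m2 measurableT.
  by rewrite preimage_setT setIT probability_setT mule1 => <-.
have mf : measurable_fun [set: T]
    (fun t => distribution P Y3 (xsection B (Y1 t, Y2 t))).
  apply: (@measurableT_comp _ _ _ _ _ _
    (fun w => distribution P Y3 (xsection B w)) _ (fun t => (Y1 t, Y2 t))).
    exact: measurable_fun_xsection.
  exact: measurable_fun_pair.
rewrite -(integral_cst P mD).
apply: (@le_trans _ _
  (\int[P]_(t in D) distribution P Y3 (xsection B (Y1 t, Y2 t)))%E).
  apply: ge0_le_integral => //.
    exact: measurable_funTS.
  by move=> t [D1t D2t]; rewrite xsectionE; exact: kP.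
exact: ge0_subset_integral.
Qed.

End independent_triple.

(** * Gamma probability of sets of small relative width *)

Section gamma_slice.
Context {R : realType} {d : measure_display} {T : measurableType d}.
Context {P : probability T R} {X : {RV P >-> R}} {a l : R}.
Hypotheses (a0 : 0 < a) (a1 : a <= 1) (l0 : 0 < l).
Hypothesis gX : gamma_distributed a l X.

Lemma gamma_gt0_ae : P [set t | 0 < X t] = 1%E.
Proof.
have -> : [set t | 0 < X t] = ~` (X @^-1` `]-oo, 0]).
  by apply/seteqP; split => t /=; rewrite in_itv/= ltNge => /negP.
rewrite probability_setC; last exact: measurable_funPTI.
by rewrite -[P (X @^-1` _)]/(distribution P X _) (gamma_le0 gX) sube0.
Qed.

(** With [m] the infimum of [S], positive thanks to [b], the set lies in [[m, m + k * m]]. *)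
Lemma gamma_slice_le (S : set R) (b k : R) : measurable S -> 0 < b -> 0 <= k ->
  (forall z, S z -> b <= z) ->
  (forall z1 z2, S z1 -> S z2 -> z1 <= z2 -> z2 - z1 <= k * z1) ->
  (distribution P X S <= (k / Gamma a)%:E)%E.
Proof.
move=> mS b0 k0 bS kS.
have G0 := Gamma_ge0 a.
have [->|/set0P S0] := eqVneq S set0.
  by rewrite measure0 lee_fin divr_ge0.
set m := inf S.
have lS : has_lbound S by exists b.
have m0 : 0 < m by apply: (lt_le_trans b0); exact: lb_le_inf.
apply: le_trans (gamma_itvcc_relative_le a0 a1 l0 gX _ _ m0 k0).
apply: le_measure; rewrite ?inE//.
move=> z Sz /=; rewrite in_itv/=; apply/andP; split; first exact: ge_inf.
have k1 : 0 < 1 + k by rewrite ltr_pwDl.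
have : z / (1 + k) <= m.
  apply: lb_le_inf => // y Sy; rewrite ler_pdivrMr//.
  have := bS _ Sy; have [zy ?|yz _] := leP z y.
    by apply: (le_trans zy); rewrite ler_peMr ?lerDl//; lra.
  by have := kS _ _ Sy Sz (ltW yz); lra.
by rewrite ler_pdivrMr//; lra.
Qed.

End gamma_slice.

(** * Law of the estimator for samples of size 3 and shape at most 1 *)

Section estimator3.
Context {R : realType} {d : measure_display} {T : measurableType d}.
Context {P : probability T R} {X : 'I_3 -> {RV P >-> R}} {a l : R}.
Hypotheses (a0 : 0 < a) (a1 : a <= 1) (l0 : 0 < l).
Hypothesis sX : gamma_sample a l X.

Let i0 : 'I_3 := ord0.
Let i1 : 'I_3 := lift ord0 ord0.
Let i2 : 'I_3 := lift ord0 (lift ord0 ord0).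
Let E : {RV P >-> R} := moment_estimator X.

Lemma moment_estimator3 t : E t = mom3 (X i0 t) (X i1 t) (X i2 t).
Proof.
rewrite -[LHS]/(sample_mean X t ^+ 2 / sample_variance X t).
rewrite /sample_variance /sample_mean /mom3.
rewrite !big_ord_recl !big_ord0 -/i0 -/i1 -/i2 !addr0.
set x := X i0 t; set y := X i1 t; set z := X i2 t.
have -> : 3^-1 * ((x - 3^-1 * (x + (y + z))) ^+ 2 +
    ((y - 3^-1 * (x + (y + z))) ^+ 2 + (z - 3^-1 * (x + (y + z))) ^+ 2)) =
    disp3 x y z / 9 by rewrite /disp3; field.
(* Without dispersion both sides take the default value 0. *)
have [->|D0] := eqVneq (disp3 x y z) 0; first by rewrite mul0r !invr0 !mulr0.
by field.
Qed.

Let gt0_ae i : P [set t | 0 < X i t] = 1%E := gamma_gt0_ae (sX.2 i).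

Let measurable_gt0 i : measurable [set t | 0 < X i t].
Proof.
rewrite (_ : [set t | _] = X i @^-1` `]0, +oo[); first exact: measurable_funPTI.
by apply/seteqP; split => t; rewrite /= in_itv/= andbT.
Qed.

(** The observations are almost surely positive, so an inclusion of events need only be checked for
    positive observations. *)
Lemma le_measure_pos (A C : set T) : measurable A -> measurable C ->
  (forall t, A t -> 0 < X i0 t -> 0 < X i1 t -> 0 < X i2 t -> C t) ->
  (P A <= P C)%E.
Proof.
move=> mA mC AC.
have n0 i : P (~` [set t | 0 < X i t]) = 0%E.
  by rewrite probability_setC// gt0_ae subee.
have mN i : measurable (~` [set t | 0 < X i t]) by exact: measurableC.
pose N := ~` [set t | 0 < X i0 t] `|` ~` [set t | 0 < X i1 t]
  `|` ~` [set t | 0 < X i2 t].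
have N0 : (P N <= 0)%E.
  apply: le_trans (measureU2 _ _ _) _ => //; first exact: measurableU.
  rewrite [X in (_ + X)%E]n0 adde0; apply: le_trans (measureU2 _ _ _) _ => //.
  by rewrite [X in (X + _)%E]n0 [X in (_ + X)%E]n0 adde0.
have mNN : measurable N by apply: measurableU => //; exact: measurableU.
apply: (@le_trans _ _ (P (C `|` N))).
  apply: le_measure; rewrite ?inE//; first exact: measurableU.
  move=> t At; apply/or_comm.
  have [x0|/negP ?] := boolP (0 < X i0 t); last by left; left; left.
  have [x1|/negP ?] := boolP (0 < X i1 t); last by left; left; right.
  have [x2|/negP ?] := boolP (0 < X i2 t); last by left; right.
  by right; exact: AC.
apply: le_trans (measureU2 _ _ _) _ => //.
by rewrite -[leRHS]adde0 leeD2l.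
Qed.

Let iX i j k : i != j -> i != k -> j != k -> independent3 (X i) (X j) (X k).
Proof. exact: mutually_independent3 sX.1. Qed.

Lemma measurable_triple_le (f g : R * R * R -> R) :
  measurable_fun setT f -> measurable_fun setT g ->
  measurable [set p | f p <= g p].
Proof.
by move=> mf mg; rewrite -[X in measurable X]setTI; exact: measurable_fun_le.
Qed.

Lemma measurable_triple_lt (f g : R * R * R -> R) :
  measurable_fun setT f -> measurable_fun setT g ->
  measurable [set p | f p < g p].
Proof.
move=> mf mg; rewrite (_ : [set p | _] = ~` [set p | g p <= f p]).
  by apply: measurableC; exact: measurable_triple_le.
by apply/seteqP; split => p /=; rewrite ltNge => /negP.
Qed.

Lemma measurable_coord1 : measurable_fun setT (fun p : R * R * R => p.1.1).
Proof. exact: measurableT_comp. Qed.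

Lemma measurable_coord2 : measurable_fun setT (fun p : R * R * R => p.1.2).
Proof. exact: measurableT_comp. Qed.

Let m1 := measurable_coord1.
Let m2 := measurable_coord2.
Let m3 : measurable_fun setT (fun p : R * R * R => p.2) := measurable_snd.

Let measurable_sum : measurable_fun setT
  (fun p : R * R * R => (p.2 + p.1.1 + p.1.2) ^+ 2).
Proof.
apply: measurable_funX; apply: measurable_funD => //; exact: measurable_funD.
Qed.

Let measurable_disp : measurable_fun setT
  (fun p : R * R * R => disp3 p.2 p.1.1 p.1.2).
Proof.
rewrite /disp3; apply: measurable_funD; first apply: measurable_funD.
all: by apply: measurable_funX; exact: measurable_funB.
Qed.

Lemma measurable_triple (Y1 Y2 Y3 : {RV P >-> R}) (B : set (R * R * R)) :
  measurable B -> measurable [set t | B ((Y1 t, Y2 t), Y3 t)].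
Proof.
move=> mB.
have mV : measurable_fun [set: T] (fun t => ((Y1 t, Y2 t), Y3 t)).
  by apply: measurable_fun_pair => //; exact: measurable_fun_pair.
by rewrite -[X in measurable X]setTI; exact: mV.
Qed.

Let comparable := [set p : R * R * R | p.1.1 / 10 <= p.2]
  `&` [set p | p.2 <= 10 * p.1.1].

Let mcomparable : measurable comparable.
Proof.
apply: measurableI; apply: measurable_triple_le => //; exact: measurable_funM.
Qed.

Let measurable_comparable i j :
  measurable [set t | (X j t / 10 <= X i t <= 10 * X j t)%R].
Proof.
have -> : [set t | (X j t / 10 <= X i t <= 10 * X j t)%R] =
    [set t | comparable ((X j t, X j t), X i t)].
  by apply/seteqP; split => t /= /andP.
exact: measurable_triple.
Qed.

Lemma comparable_pair_le i j : i != j ->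
  (P [set t | (X j t / 10 <= X i t <= 10 * X j t)%R] <= (99 / Gamma a)%:E)%E.
Proof.
move=> ij.
(* The third index completes the triple to which conditioning applies. *)
have [k /andP[ik jk]] : exists k, (i != k) && (j != k).
  by case: i j ij => [[|[|[|//]]] ?] [[|[|[|//]]] ?] // _;
    do ?[by exists i0 | by exists i1 | by exists i2].
have -> : [set t | (X j t / 10 <= X i t <= 10 * X j t)%R] =
    [set t | comparable ((X j t, X k t), X i t)].
  by apply/seteqP; split => t /= /andP.
apply: (independent3_le (iX _ _ _ _ _ _)) => //; rewrite 1?eq_sym//.
  by rewrite divr_ge0 ?Gamma_ge0.
move=> b c b0 c0.
have b10 : 0 < b / 10 by rewrite divr_gt0.
(* The interval from b/10 to 10b has length 99 times its left endpoint. *)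
apply: le_trans (gamma_itvcc_relative_le a0 a1 l0 (sX.2 i) _ 99 b10 _) => //.
apply: le_measure; rewrite ?inE//.
  have := measurable_xsection (b, c) mcomparable; rewrite xsectionE; exact.
by move=> x [/= h1 h2]; rewrite in_itv/= h1/=; lra.
Qed.

(** A value above 1 forces two observations to be within a factor 10 of each other. The three pairs
    give 3 * 99 = 297, rounded up to 300. *)
Lemma moment_estimator_gt1_le :
  (P [set t | (1 < E t)%R] <= (300 / Gamma a)%:E)%E.
Proof.
apply: (@le_trans _ _ (P (
    [set t | (X i1 t / 10 <= X i0 t <= 10 * X i1 t)%R] `|`
    [set t | (X i2 t / 10 <= X i0 t <= 10 * X i2 t)%R] `|`
    [set t | (X i2 t / 10 <= X i1 t <= 10 * X i2 t)%R]))).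
  apply: le_measure_pos.
  - rewrite (_ : [set t | _] = E @^-1` `]1, +oo[).
      exact: measurable_funPTI.
    by apply/seteqP; split => t; rewrite /= in_itv/= andbT.
  - by apply: measurableU => //; exact: measurableU.
  - move=> t /=; rewrite moment_estimator3 => + x0 y0 z0.
    by case/(mom3_gt1 _ _ _ x0 y0 z0) => ?; [left; left|left; right|right].
apply: le_trans (measureU2 _ _ _) _ => //; first exact: measurableU.
have -> : 300 / Gamma a =
  99 / Gamma a + 99 / Gamma a + 99 / Gamma a + 3 / Gamma a by ring.
rewrite !EFinD -[leLHS]adde0; apply: leeD; last first.
  by rewrite lee_fin divr_ge0 ?Gamma_ge0.
apply: leeD; last exact: comparable_pair_le.
apply: le_trans (measureU2 _ _ _) _ => //.
by apply: leeD; exact: comparable_pair_le.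
Qed.

(** A value at most 1/2 forces two observations to coincide; given one of them, the other is
    confined to a single point, a slice of relative width 0. *)
Lemma cdf_moment_estimator_half : cdf E 2^-1 = 0%E.
Proof.
apply/eqP; rewrite -measure_le0.
pose B := [set p : R * R * R | p.1.1 <= p.2] `&` [set p | p.2 <= p.1.1].
have mB : measurable B by apply: measurableI; exact: measurable_triple_le.
apply: (@le_trans _ _ (P [set t | B ((X i0 t, X i2 t), X i1 t)])).
  apply: le_measure_pos; [exact: measurable_funPTI|exact: measurable_triple|].
  move=> t; rewrite /= in_itv/= moment_estimator3 => m x0 y0 z0.
  by rewrite /B/= (mom3_le_half _ _ _ x0 y0 z0 m).
apply: (independent3_le (iX _ _ _ _ _ _)) => //.
move=> b c b0 c0; rewrite -[X in (_ <= X%:E)%E](mul0r (Gamma a)^-1).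
apply: (gamma_slice_le a0 a1 l0 (sX.2 _) _ _ _ _ b0) => //.
- have := measurable_xsection (b, c) mB; rewrite xsectionE; exact.
- by move=> z [].
- by move=> z1 z2 [/= ? ?] [/= ? ?] _; lra.
Qed.

(** Given the two smaller observations, the largest one is confined by [mom3_slice] to a set of
    relative width [14 / e * (v - u)]; the three choices of the largest give 42. *)
Lemma moment_estimator_itv_le e u v :
  0 < e -> 2^-1 + e <= u -> u <= v -> v <= 1 ->
  (P [set t | (u < E t <= v)%R] <= (42 / Gamma a / e * (v - u))%:E)%E.
Proof.
move=> e0 ue uv v1.
pose B := [set p : R * R * R | p.1.1 <= p.2] `&` [set p | p.1.2 <= p.2] `&`
  [set p | (p.2 + p.1.1 + p.1.2) ^+ 2 <= v * disp3 p.2 p.1.1 p.1.2] `&`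
  [set p | u * disp3 p.2 p.1.1 p.1.2 < (p.2 + p.1.1 + p.1.2) ^+ 2].
have mB : measurable B.
  apply: measurableI; last first.
    by apply: measurable_triple_lt => //; exact: measurable_funM.
  apply: measurableI; first by apply: measurableI; exact: measurable_triple_le.
  by apply: measurable_triple_le => //; exact: measurable_funM.
have PB i j k : i != j -> i != k -> j != k ->
    (P [set t | B ((X j t, X k t), X i t)] <=
      (14 / e * (v - u) / Gamma a)%:E)%E.
  move=> ij ik jk.
  have k0 : 0 <= 14 / e * (v - u) by rewrite mulr_ge0 ?divr_ge0 ?subr_ge0// ltW.
  apply: (independent3_le (iX _ _ _ _ _ _)) => //; rewrite 1?eq_sym//.
    by rewrite divr_ge0 ?Gamma_ge0.
  move=> b c b0 c0; apply: (gamma_slice_le a0 a1 l0 (sX.2 i) _ _ _ _ b0) => //.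
  - have := measurable_xsection (b, c) mB; rewrite xsectionE; exact.
  - by move=> z [[[]]].
  - move=> z1 z2 [[[/= bz1 cz1] h1] _] [_ /= h2] z12.
    exact: (mom3_slice _ _ _ b c).
have mS i j k : measurable [set t | B ((X j t, X k t), X i t)].
  exact: measurable_triple.
apply: (@le_trans _ _ (P (
    [set t | B ((X i1 t, X i2 t), X i0 t)] `|`
    [set t | B ((X i0 t, X i2 t), X i1 t)] `|`
    [set t | B ((X i0 t, X i1 t), X i2 t)]))).
  apply: le_measure_pos.
  - rewrite (_ : [set t | _] = E @^-1` `]u, v]); first exact: measurable_funPTI.
    by apply/seteqP; split => t; rewrite /= in_itv.
  - by apply: measurableU => //; exact: measurableU.
  - have BP x y z : y <= x -> z <= x -> u < mom3 x y z -> mom3 x y z <= v ->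
        B ((y, z), x).
      move=> yx zx h1 h2.
      have u0 : 0 <= u by lra.
      have [D0 hu] := mom3_gtP _ _ _ _ u0 h1.
      by move: h2; rewrite mom3_le.
    move=> t /=; rewrite moment_estimator3 => /andP[h1 h2] x0 y0 z0.
    move: h1 h2; set x := X i0 t; set y := X i1 t; set z := X i2 t => h1 h2.
    have [xy|yx] := leP x y; last have [xz|zx] := leP x z.
    + have [yz|zy] := leP y z.
      * by right; apply: BP; rewrite -1?mom3_perm312//; exact: le_trans yz.
      * by left; right; apply: BP; rewrite -1?mom3_perm213// ltW.
    + right; apply: BP; rewrite -1?mom3_perm312//.
      by apply: ltW; apply: lt_le_trans xz.
    + by left; left; apply: BP => //; exact: ltW.
apply: le_trans (measureU2 _ _ _) _ => //; first exact: measurableU.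
have -> : 42 / Gamma a / e * (v - u) = 14 / e * (v - u) / Gamma a +
    14 / e * (v - u) / Gamma a + 14 / e * (v - u) / Gamma a.
  by ring.
rewrite !EFinD; apply: leeD; last exact: PB.
apply: le_trans (measureU2 _ _ _) _ => //.
by apply: leeD; exact: PB.
Qed.

(** For [h <= 2], the condition that the estimator exceeds [2 - h], written without division. *)
Let B2 h := [set p : R * R * R | 0 < disp3 p.2 p.1.1 p.1.2] `&`
  [set p | (2 - h) * disp3 p.2 p.1.1 p.1.2 < (p.2 + p.1.1 + p.1.2) ^+ 2].

Let measurable_B2 h : measurable (B2 h).
Proof.
apply: measurableI; first by apply: measurable_triple_lt.
by apply: measurable_triple_lt => //; exact: measurable_funM.
Qed.

(** The gamma density is positive, so the box of [mom3_box] has positive probability. *)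
Lemma moment_estimator_gt2_gt0 : (0 < P [set t | (2 < E t)%R])%E.
Proof.
pose I1 := `](12 / 10), (13 / 10 : R)]%classic.
pose I2 := `](14 / 10), (15 / 10 : R)]%classic.
have pI (i : 'I_3) (u v : R) : 0 < u -> u < v ->
    exists2 k : R, 0 < k & (k%:E <= distribution P (X i) `]u, v]%classic)%E.
  move=> u0 uv; exists ((v - u) * gamma_pdf a l v).
    by rewrite mulr_gt0 ?subr_gt0// (gamma_pdf_gt0 l0 (sX.2 i))// (lt_trans u0).
  by apply: (gamma_itv_ge a1 l0 (sX.2 i)) => //; exact: ltW.
have [k1 k10 k1P] := pI i1 (12 / 10) (13 / 10) ltac:(lra) ltac:(lra).
have [k2 k20 k2P] := pI i2 (14 / 10) (15 / 10) ltac:(lra) ltac:(lra).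
have [k3 k30 k3P] := pI i0 1 (11 / 10) ltac:(lra) ltac:(lra).
have mB := measurable_B2 0.
have -> : [set t | (2 < E t)%R] = [set t | B2 0 ((X i1 t, X i2 t), X i0 t)].
  apply/seteqP; split => t /=; rewrite moment_estimator3 /B2/= subr0.
    by move=> /mom3_gtP; apply.
  by move=> [D0 h]; rewrite mom3_gt.
have iYs : independent3 (X i1) (X i2) (X i0) by exact: iX.
apply: lt_le_trans (independent3_ge iYs _ I1 I2 k3 mB _ _ _ _).
- rewrite mule_gt0 ?lte_fin// mule_gt0//.
    by apply: lt_le_trans k1P; rewrite lte_fin.
  by apply: lt_le_trans k2P; rewrite lte_fin.
- exact: measurable_itv.
- exact: measurable_itv.
- exact: ltW.
- move=> b c; rewrite /I1 /I2 /= !in_itv/= => /andP[b1 b2] /andP[c1 c2].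
  apply: le_trans k3P _; apply: le_measure; rewrite ?inE//.
    have := measurable_xsection (b, c) mB; rewrite xsectionE; exact.
  move=> x; rewrite /= in_itv/= => /andP[x1 x2].
  have /mom3_gtP : 2 < mom3 x b c by apply: mom3_box; apply/andP; split; lra.
  by rewrite /B2/= subr0; apply.
Qed.

(** One observation is taken in []1, 2]] and one in []p ^+ 4 / 2, p ^+ 4]], the latter with
    probability at least of order p. Given these, [mom3_steep] provides a window for the remaining
    one, of probability at least of order h / p^2. For small [p] the resulting slope 1 / p is
    arbitrarily large. *)
Lemma moment_estimator_steep : a = 4^-1 -> exists2 k : R, 0 < k &
  forall p h : R, 0 < p -> p <= 1 -> 0 < h -> h <= p ^+ 4 ->
    ((k * (h / p))%:E <= P [set t | (2 - h < E t <= 2)%R])%E.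
Proof.
move=> a4.
have G0 := Gamma_gt0 (sX.2 i0).
have pdf0 u : 0 < u -> 0 < gamma_pdf a l u.
  exact: (gamma_pdf_gt0 l0 (sX.2 i0)).
exists (gamma_pdf a l 7 * gamma_pdf a l 2 *
    (l^-1 `^ a * expR (- l^-1) / Gamma a) / 96).
  by rewrite !(mulr_gt0, divr_gt0, pdf0, powR_gt0, expR_gt0, invr_gt0).
move=> p h p0 p1 h0 hp.
pose B := B2 h `&`
  [set q : R * R * R | (q.2 + q.1.1 + q.1.2) ^+ 2 <= 2 * disp3 q.2 q.1.1 q.1.2].
have mB : measurable B.
  apply: measurableI; first exact: measurable_B2.
  by apply: measurable_triple_le => //; exact: measurable_funM.
have h1 : h <= 1 by apply: (le_trans hp); rewrite exprn_ile1// ltW.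
have -> : [set t | (2 - h < E t <= 2)%R] =
    [set t | B ((X i1 t, X i2 t), X i0 t)].
  apply/seteqP; split => t /=; rewrite moment_estimator3.
    move=> /andP[m1t m2t].
    have h2 : 0 <= 2 - h by lra.
    have [D0 H] := mom3_gtP _ _ _ _ h2 m1t.
    by move: m2t; rewrite mom3_le.
  by move=> [[/= D0 h2] h3]; rewrite mom3_gt// mom3_le//; apply/andP.
have iYs : independent3 (X i1) (X i2) (X i0) by exact: iX.
pose I1 := `]1, (2 : R)]%classic.
pose I2 := `]p ^+ 4 / 2, p ^+ 4]%classic.
have p20 : 0 < p ^+ 2 by rewrite exprn_gt0.
have p40 : 0 < p ^+ 4 by rewrite exprn_gt0.
set s := h / (48 * p ^+ 2).
have s0 : 0 < s by rewrite divr_gt0// mulr_gt0.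
pose k3 := s * gamma_pdf a l 7.
have k30 : 0 <= k3 by rewrite mulr_ge0 ?ltW// pdf0.
apply: le_trans (independent3_ge iYs _ I1 I2 k3 mB _ _ _ _) => //.
- have I1P := gamma_itv_ge a1 l0 (sX.2 i1) 1 2 ler01 ltac:(lra).
  have I2P := gamma_itv_ge a1 l0 (sX.2 i2) (p ^+ 4 / 2) (p ^+ 4)
    ltac:(lra) ltac:(lra).
  apply: le_trans (lee_pmul _ _ (lexx _) (lee_pmul _ _ I1P I2P)); last 4 first.
  + by rewrite lee_fin.
  + by rewrite mule_ge0// lee_fin mulr_ge0 ?gamma_pdf_ge0//; lra.
  + by rewrite lee_fin mulr_ge0 ?gamma_pdf_ge0//; lra.
  + by rewrite lee_fin mulr_ge0 ?gamma_pdf_ge0//; lra.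
  rewrite -!EFinM lee_fin.
  have -> : (p ^+ 4 - p ^+ 4 / 2) * gamma_pdf a l (p ^+ 4) =
      2^-1 * (p ^+ 4 * gamma_pdf a l (p ^+ 4)) by field.
  rewrite mulr_gamma_pdf//.
  (* The shape 1/4 turns p^4 into p. *)
  have -> : (p ^+ 4 / l) `^ a = p * l^-1 `^ a.
    rewrite powRM ?invr_ge0 ?ltW// -powR_mulrn ?ltW// -powRrM a4.
    by rewrite divff// powRr1// ltW.
  have e1 : expR (- l^-1) <= expR (- (p ^+ 4 / l)).
    rewrite ler_expR lerN2 -[leRHS]mul1r ler_pM2r ?invr_gt0//.
    by rewrite exprn_ile1// ltW.
  set x7 := gamma_pdf a l 7; set x2 := gamma_pdf a l 2; set y := l^-1 `^ a.
  have -> : x7 * x2 * (y * expR (- l^-1) / Gamma a) / 96 * (h / p) =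
     k3 * ((2 - 1) * x2 * (2^-1 * (p * y * expR (- l^-1) / Gamma a))).
    by rewrite /k3 /s -/x7; field; rewrite !gt_eqF.
  rewrite ler_wpM2l// ler_wpM2l//.
    by rewrite mulr_ge0 ?gamma_pdf_ge0//; lra.
  rewrite ler_wpM2l// ler_wpM2r ?invr_ge0 ?Gamma_ge0// ler_wpM2l//.
  by rewrite mulr_ge0 ?powR_ge0// ltW.
- exact: measurable_itv.
- exact: measurable_itv.
- move=> b c; rewrite /I1 /I2 /= !in_itv/= => /andP[b1 b2] /andP[c1 c2].
  have c0 : 0 < c by lra.
  set w := Num.sqrt (4 * (b * c)).
  have w0 : 0 <= w by exact: sqrtr_ge0.
  have wE : w ^+ 2 = 4 * (b * c).
    by rewrite sqr_sqrtr// !mulr_ge0//; lra.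
  have steep x : b + c + w <= x <= b + c + w + s ->
     [/\ x <= 7, 0 < disp3 x b c, (x + b + c) ^+ 2 <= 2 * disp3 x b c &
     (2 - h) * disp3 x b c < (x + b + c) ^+ 2].
    move=> xP; apply: (mom3_steep p h b c w x) => //.
      by apply/andP; split => //; lra.
    by apply/andP; split => //; lra.
  have u0 : 0 <= b + c + w by rewrite !addr_ge0//; lra.
  have us : b + c + w <= b + c + w + s by rewrite lerDl ltW.
  apply: (@le_trans _ _
    (distribution P (X i0) `]b + c + w, b + c + w + s]%classic)).
    apply: le_trans (gamma_itv_ge a1 l0 (sX.2 i0) _ _ u0 us).
    rewrite lee_fin addrAC subrr add0r ler_wpM2l ?(ltW s0)//.
    have [x7 _ _ _] := steep (b + c + w + s) ltac:(by rewrite us lexx).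
    apply: gamma_pdf_nonincreasing => //.
    by apply: (@lt_le_trans _ _ b); lra.
  apply: le_measure; rewrite ?inE//.
    have := measurable_xsection (b, c) mB; rewrite xsectionE; exact.
  move=> x; rewrite /= in_itv/= => /andP[x1 x2].
  by have [] := steep x ltac:(by rewrite (ltW x1) x2).
Qed.

End estimator3.

(** * Distribution functions and their generalised inverses *)

Section cdf_quantile.
Context {R : realType} {d : measure_display} {T : measurableType d}.
Context {P : probability T R} {Z : {RV P >-> R}}.

Lemma cdf_itvoc u v : u <= v ->
  cdf Z v = (cdf Z u + P [set t | (u < Z t <= v)%R])%E.
Proof.
move=> uv.
have -> : [set t | (u < Z t <= v)%R] = Z @^-1` `]u, v].
  by apply/seteqP; split => t; rewrite /= in_itv.
rewrite /cdf -[P _]/(distribution P Z _) -measureU//; last first.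
  apply/seteqP; split => // x [] /=; rewrite !in_itv/= => xu /andP[].
  by rewrite ltNge xu.
by congr (distribution P Z _); apply: itv_bndbnd_setU; rewrite bnd_simp.
Qed.

(** The point [b] bounds from below the set whose infimum is the quantile. *)
Lemma quantile_le {p b x} : (cdf Z b < p)%E -> (p <= cdf Z x)%E ->
  quantile Z p <= x.
Proof.
move=> bp px; apply: ge_inf => //; exists b => y /= py.
by rewrite leNgt; apply/negP => yb; have := le_lt_trans (le_trans py
  (cdf_nondecreasing Z (ltW yb))) bp; rewrite ltxx.
Qed.

Lemma le_quantile {p b x} : (cdf Z b < p)%E -> (p <= cdf Z x)%E ->
  b <= quantile Z p.
Proof.
move=> bp px; apply: lb_le_inf; first by exists x.
move=> y /= py; rewrite leNgt; apply/negP => yb.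
have := le_lt_trans (le_trans py (cdf_nondecreasing Z (ltW yb))) bp.
by rewrite ltxx.
Qed.

(** By right continuity of the distribution function the infimum is attained. *)
Lemma cdf_quantile_ge {p b x} : (cdf Z b < p)%E -> (p <= cdf Z x)%E ->
  (p <= cdf Z (quantile Z p))%E.
Proof.
move=> bp px; set q := quantile Z p.
have H : cdf Z r @[r --> q^'+] --> cdf Z q by exact: cdf_right_continuous.
have -> : cdf Z q = lim (cdf Z r @[r --> q^'+]) by exact/esym/cvg_lim.
apply: lime_ge; first by apply/cvg_ex; exists (cdf Z q).
near=> r.
have [y py yr] : exists2 y, (p <= cdf Z y)%E & y < r.
  have : q < r by near: r; exact: nbhs_right_gt.
  by case/inf_lt => [|y]; [exists x|exists y].
by apply: le_trans py _; exact/cdf_nondecreasing/ltW.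
Unshelve. all: by end_near.
Qed.

End cdf_quantile.

(** * Failure of the star order from a Lipschitz bound and a steep point *)

Section star_contradiction.
Context {R : realType}.
Context {d1 : measure_display} {T1 : measurableType d1} {P1 : probability T1 R}.
Context {d2 : measure_display} {T2 : measurableType d2} {P2 : probability T2 R}.
Context {X : {RV P1 >-> R}} {Y : {RV P2 >-> R}}.

(** Finite differences replace derivatives: from [q] to [q - s] the quantile of [Y] drops from at
    most 2 by at most some [h <= s], too little for its quotient by the argument to be
    nondecreasing. *)
Lemma not_star_le (C k : R) : 0 < C -> 0 < k ->
  cdf X 2^-1 = 0%E -> cdf Y 2^-1 = 0%E -> (cdf Y 2 < cdf X 1)%E ->
  (forall e u v : R, 0 < e -> 2^-1 + e <= u -> u <= v -> v <= 1 ->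
     (P1 [set t | (u < X t <= v)%R] <= (C / e * (v - u))%:E)%E) ->
  (forall p h : R, 0 < p -> p <= 1 -> 0 < h -> h <= p ^+ 4 ->
     ((k * (h / p))%:E <= P2 [set t | (2 - h < Y t <= 2)%R])%E) ->
  ~ star_le X Y.
Proof.
move=> C0 k0 X0 Y0 YX lipX steepY XY.
pose p := fine (cdf Y 2).
have pE : cdf Y 2 = p%:E by rewrite fineK// fin_num_measure.
have p0 : 0 < p.
  have := steepY 1 1 ltr01 (lexx _) ltr01; rewrite expr1n => /(_ (lexx _)) H.
  rewrite -lte_fin -pE (cdf_itvoc 1) ?ler1n//.
  apply: lt_le_trans (_ : (k%:E <= _)%E); first by rewrite lte_fin.
  rewrite -[leLHS]add0e; apply: leeD => //.
  by move: H; rewrite divr1 mulr1 (_ : 2 - 1 = 1 :> R)//; lra.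
have p1 : p < 1.
  rewrite -lte_fin -pE; apply: lt_le_trans YX _; exact: cdf_le1.
have X0p : (cdf X 2^-1 < p%:E)%E by rewrite X0 lte_fin.
have pX1 : (p%:E <= cdf X 1)%E by rewrite -pE ltW.
pose q := quantile X p%:E.
have q1 : q <= 1 by exact: quantile_le X0p pX1.
have q2 : 2^-1 <= q by exact: le_quantile X0p pX1.
have pq : (p%:E <= cdf X q)%E by exact: cdf_quantile_ge X0p pX1.
have {}q2 : 2^-1 < q.
  rewrite lt_neqAle q2 andbT; apply/eqP => qE.
  by move: pq; rewrite -qE X0 lee_fin leNgt p0.
(* Half the distance from 1/2 to [q], so that the Lipschitz bound holds on [[q - e, q]]. *)
pose e := (q - 2^-1) / 2.
have e0 : 0 < e by rewrite divr_gt0// subr_gt0.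
have lt_q x : x < q -> (cdf X x < p%:E)%E.
  move=> xq; rewrite ltNge; apply/negP => px.
  by have := quantile_le X0p px; rewrite leNgt xq.
pose D := C / e.
have D0 : 0 < D by rewrite divr_gt0.
have left_q x : 2^-1 + e <= x -> x <= q ->
    (cdf X q <= cdf X x + (D * (q - x))%:E)%E.
  move=> ex xq; rewrite (cdf_itvoc _ _ xq) leeD2l//.
  exact: lipX.
(* The Lipschitz bound excludes a jump at [q]. *)
clearbody D; have qE : cdf X q = p%:E.
  apply/eqP; rewrite eq_le pq andbT.
  apply/lee_addgt0Pr => r r0.
  pose s := Num.min e (r / D).
  have s0 : 0 < s by rewrite lt_min e0 divr_gt0.
  have se : s <= e by rewrite ge_min lexx.
  have sr : s <= r / D by rewrite ge_min lexx orbT.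
  apply: le_trans (left_q (q - s) _ _) _; [rewrite /e in se *; lra|lra|].
  apply: leeD; first by apply/ltW/lt_q; lra.
  by rewrite lee_fin; move: sr; rewrite ler_pdivlMr//; lra.
have D20 : 0 < 2 * D by lra.
pose rho := Num.min 1 (k / (2 * D)).
have rho0 : 0 < rho by rewrite lt_min ltr01 divr_gt0// mulr_gt0.
have rho1 : rho <= 1 by rewrite ge_min lexx.
have rhok : 2 * D * rho <= k.
  have : rho <= k / (2 * D) by rewrite ge_min lexx orbT.
  by rewrite ler_pdivlMr//; lra.
(* The three bounds keep [q - s] in the Lipschitz range, keep the distribution function positive
   there, and give [h <= rho ^+ 4] below. *)
pose s := Num.min e (Num.min (p / (2 * D)) (k * rho ^+ 3 / (2 * D))).
have s0 : 0 < s.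
  by rewrite !lt_min e0 !divr_gt0// mulr_gt0// exprn_gt0.
have se : s <= e by rewrite ge_min lexx.
have sp : s * (2 * D) <= p.
  have : s <= p / (2 * D) by rewrite !ge_min lexx orbT.
  by rewrite ler_pdivlMr.
have sk : s * (2 * D) <= k * rho ^+ 3.
  have : s <= k * rho ^+ 3 / (2 * D) by rewrite !ge_min lexx !orbT.
  by rewrite ler_pdivlMr.
(* Chosen so that [k * (h / rho)] is [2 * D * s], twice the largest possible drop of the
   distribution function of [X]; the choice of [rho] makes [h <= s]. *)
pose h := 2 * D * rho * s / k.
have h0 : 0 < h by rewrite divr_gt0// !mulr_gt0.
have hk : h * k = 2 * D * rho * s by rewrite /h divfK// gt_eqF.
have hs : h <= s by rewrite -(ler_pM2r k0) hk; nra.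
have hrho : h <= rho ^+ 4.
  rewrite -(ler_pM2r k0) hk
    (_ : rho ^+ 4 * k = (k * rho ^+ 3) * rho); last by ring.
  by rewrite (_ : 2 * D * rho * s = s * (2 * D) * rho) ?ler_pM2r//; ring.
pose x := q - s.
have x12 : 2^-1 + e <= x by rewrite /x /e in se *; lra.
have xq : x <= q by rewrite /x; lra.
have x0 : 0 < x by lra.
have q0 : 0 < q by lra.
pose Fx := fine (cdf X x).
have FxE : cdf X x = Fx%:E by rewrite fineK// fin_num_measure.
have Fxp : Fx < p by rewrite -lte_fin -FxE; apply: lt_q; rewrite /x; lra.
have Fxge : p - D * s <= Fx.
  have := left_q x x12 xq; rewrite qE FxE -EFinD lee_fin /x.
  lra.
have Fx0 : 0 < Fx by nra.
have qS : [set x | 0 < x /\ (0 < cdf X x < 1)%E] q.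
  by split => //; rewrite qE !lte_fin p0.
have xS : [set x | 0 < x /\ (0 < cdf X x < 1)%E] x.
  by split => //; rewrite FxE !lte_fin Fx0 (lt_trans Fxp).
have := XY x q; rewrite !inE => /(_ xS qS xq); rewrite qE FxE.
have Yp : (cdf Y 2^-1 < p%:E)%E by rewrite Y0 lte_fin.
have Qq : quantile Y p%:E <= 2 by apply: quantile_le Yp _; rewrite pE.
(* At [2 - h] the distribution function of [Y] is at most p - 2Ds, below p - Ds <= [Fx]. *)
have Qx : 2 - h <= quantile Y Fx%:E.
  apply: (@le_quantile _ _ _ _ _ _ _ 2); last by rewrite pE lee_fin ltW.
  have H : 2 - h <= 2 by lra.
  have {H} := @cdf_itvoc _ _ _ _ Y _ _ H; rewrite pE => H.
  have := steepY rho h rho0 rho1 h0 hrho.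
  set G := cdf Y (2 - h) in H *.
  have Gfin : G \is a fin_num by rewrite fin_num_measure.
  rewrite -(leeD2lE _ _ Gfin) -H -(fineK Gfin) -EFinD lee_fin lte_fin.
  have -> : k * (h / rho) = 2 * (D * s).
    by rewrite mulrA (mulrC k) hk; field; rewrite gt_eqF.
  by nra.
rewrite ler_pdivrMr// mulrAC ler_pdivlMr// => Hqx.
have : (2 - h) * q <= 2 * x.
  apply: le_trans (_ : _ <= quantile Y Fx%:E * q) _; first by rewrite ler_pM2r.
  by apply: le_trans Hqx _; rewrite ler_pM2r.
(* The inequality reads 2s <= hq, while hq <= h <= s and s > 0. *)
rewrite /x; nra.
Qed.

End star_contradiction.

(** * Choice of the two shapes *)

Theorem corollary3 (R : realType) (l : R) (l_gt0 : 0 < l)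
    (d : R -> measure_display) (T : forall a : R, measurableType (d a))
    (P : forall a : R, probability (T a) R)
    (X : forall a : R, 'I_3 -> {RV (P a) >-> R})
    (sampleX : forall a : R, 0 < a -> gamma_sample a l (X a)) :
  ~ (forall a1 a2 : R, 0 < a1 -> a1 < a2 ->
       star_le (P1 := P a1) (moment_estimator (X a1))
               (P2 := P a2) (moment_estimator (X a2))).
Proof.
pose a2 : R := 4^-1.
have a2_gt0 : 0 < a2 by rewrite invr_gt0.
have a2_le1 : a2 <= 1 by rewrite invf_le1// ler1n.
have s2 := sampleX _ a2_gt0.
have gt_split a (Z : {RV P a >-> R}) u :
    (cdf Z u + P a [set t | (u < Z t)%R] = 1)%E.
  rewrite -(probability_setT (distribution (P a) Z)).
  have -> : [set t | (u < Z t)%R] = Z @^-1` `]u, +oo[.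
    by apply/seteqP; split => t; rewrite /= in_itv/= andbT.
  rewrite /cdf -[P a _]/(distribution (P a) Z _) -measureU//; last first.
    apply/seteqP; split => // x [] /=; rewrite !in_itv/= => xu.
    by rewrite ltNge xu.
  congr (distribution (P a) Z _); apply/seteqP; split => // x _ /=.
  by rewrite !in_itv/= andbT; case: (leP x u); [left|right].
set Y : {RV P a2 >-> R} := moment_estimator (X a2).
have Y2 : (cdf Y 2 < 1)%E.
  rewrite -(gt_split _ Y 2) -[ltLHS]adde0 lteD2lE ?fin_num_measure//.
  exact: moment_estimator_gt2_gt0 a2_le1 l_gt0 s2.
pose p := fine (cdf Y 2).
have pE : cdf Y 2 = p%:E by rewrite fineK// fin_num_measure.
have p1 : 0 < 1 - p by rewrite subr_gt0 -lte_fin -pE.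
(* The 4 makes 1/(n+1) less than 1/4. As Gamma(1/(n+1)) >= (n+1) / (4e), the bound 300 /
   Gamma(1/(n+1)) is at most 1200 e / (n+1), which the second term makes less than 1 - p. *)
pose n := maxn 4 (Num.bound (1200 * expR 1 / (1 - p))).
pose a1 : R := n.+1%:R^-1.
have a1_gt0 : 0 < a1 by rewrite invr_gt0.
have a1_le1 : a1 <= 1 by rewrite invf_le1// ler1n.
have a12 : a1 < a2 by rewrite ltf_pV2 ?posrE// ltr_nat ltnS leq_maxl.
have s1 := sampleX _ a1_gt0.
set Z : {RV P a1 >-> R} := moment_estimator (X a1).
have G1 : 0 < Gamma a1 := Gamma_gt0 (s1.2 ord0).
have nG : 300 / Gamma a1 < 1 - p.
  have nE : 1200 * expR 1 / (1 - p) < n.+1%:R.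
    apply: lt_le_trans (archi_boundP _) _.
      apply: divr_ge0; last exact: ltW.
      by apply: mulr_ge0; [exact: ler0n|exact: expR_ge0].
    by rewrite ler_nat leqW// /n leq_maxr.
  have := Gamma_inv_nat_ge _ n _ _ _ _ l_gt0 (s1.2 ord0); rewrite -/a1.
  rewrite ler_pdivrMr ?mulr_gt0 ?expR_gt0// => nG.
  move: nE; rewrite ltr_pdivrMr// ltr_pdivrMr// => nE.
  have := expR_gt0 (1 : R); nra.
have [k k0 steep] := moment_estimator_steep a2_gt0 a2_le1 l_gt0 s2 erefl.
move=> /(_ a1 a2 a1_gt0 a12); apply: (not_star_le (42 / Gamma a1) k) => //.
- by rewrite divr_gt0.
- exact: cdf_moment_estimator_half a1_gt0 a1_le1 l_gt0 s1.
- exact: cdf_moment_estimator_half a2_gt0 a2_le1 l_gt0 s2.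
- rewrite pE.
  have := moment_estimator_gt1_le a1_gt0 a1_le1 l_gt0 s1; rewrite -/Z => H.
  have := gt_split _ Z 1; set F := cdf Z 1.
  have Ff : F \is a fin_num by rewrite fin_num_measure.
  have {}H : (P a1 [set t | (1 < Z t)%R] < (1 - p)%:E)%E.
    by apply: le_lt_trans H _; rewrite lte_fin.
  move=> FE; have : (F + P a1 [set t | (1 < Z t)%R] < F + (1 - p)%:E)%E.
    by rewrite lteD2lE.
  rewrite FE -(fineK Ff) -EFinD !lte_fin; lra.
- exact: moment_estimator_itv_le a1_gt0 a1_le1 l_gt0 s1.
Qed.
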